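(* Let $\mathbf{V}$ be a variety of groups. The class of all integrals of groups in $\mathbf{V}$ is a variety; indeed it is the product variety $\mathbf{V}\mathbf{A}$, where $\mathbf{A}$ is the variety of abelian groups.
   Context: For a group $H$, $H'$ denotes the derived group (commutator subgroup). An integral of a group $G$ is a group $H$ such that $H'\cong G$. A variety of groups is the class of all groups satisfying a given set of identities. For varieties $\mathbf{V}$ and $\mathbf{W}$, the product $\mathbf{V}\mathbf{W}$ is the class of all groups $H$ having a normal subgroup $N\in\mathbf{V}$ with $H/N\in\mathbf{W}$. *)

(* Defs.v *)
From HB Require Import structures.
From mathcomp Require Import all_boot.
From mathcomp Require Import boolp.

Set Implicit Arguments.
Unset Strict Implicit.
Unset Printing Implicit Defensive.

Local Open Scope group_scope.
Local Open Scope quotient_scope.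

(* Groups are arbitrary, possibly infinite, [groupType]s, and subgroups are
   [groupClosed] boolean predicates.  Under the classical axioms of [boolp],
   the choice operator of a [groupType] and the decidability of membership in
   a subgroup are no restriction. *)

Section SubgroupAsGroup.
Variables (G : groupType) (S : groupClosed G).

Definition subgroup : Type := {x : G | x \in S}.

HB.instance Definition _ := [isSub of subgroup for @sval G (fun x => x \in S)].
HB.instance Definition _ := [Choice of subgroup by <:].

Lemma subgroup_group_closed : group_closed (fun x => x \in S).
Proof.
by split=> [|x y]; rewrite -!topredE /=; [exact: gpred1 | exact: gpredF].
Qed.

HB.instance Definition _ :=
  SubChoice_isSubGroup.Build G (fun x => x \in S) subgroup
    subgroup_group_closed.

End SubgroupAsGroup.

Definition normal (G : groupType) (N : groupClosed G) : Prop :=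
  forall x y : G, x \in N -> x ^ y \in N.

Section QuotientGroup.
Variables (G : groupType) (N : groupClosed G).

Definition coset_rel (x y : G) : bool := x^-1 * y \in N.

Lemma coset_rel_refl : reflexive coset_rel.
Proof. by move=> x; rewrite /coset_rel mulVg gpred1. Qed.

Lemma coset_rel_sym : symmetric coset_rel.
Proof. by move=> x y; rewrite /coset_rel -gpredV invgM invgK. Qed.

Lemma coset_rel_trans : transitive coset_rel.
Proof.
move=> y x z Hxy Hyz; rewrite /coset_rel.
by rewrite -(mulVKg y z) mulgA gpredM.
Qed.

Canonical coset_equiv :=
  EquivRel coset_rel coset_rel_refl coset_rel_sym coset_rel_trans.

(* The proof of normality is a parameter so that the group structure below can
   be attached to this type. *)
Definition quotient_by of normal N : Type := {eq_quot coset_rel}.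

Variable nN : normal N.
Local Notation Q := (quotient_by nN).

HB.instance Definition _ := Choice.on Q.
HB.instance Definition _ : EqQuotient G coset_rel Q :=
  EqQuotient.on Q.

Definition quotient_one : Q := \pi_Q 1.
Definition quotient_inv (a : Q) : Q := \pi_Q (repr a)^-1.
Definition quotient_mul (a b : Q) : Q := \pi_Q (repr a * repr b).

Lemma quotient_eqE x y : (\pi_Q x = \pi_Q y) <-> coset_rel x y.
Proof. by rewrite -[coset_rel x y]/(coset_equiv x y); split=> [/eqmodP|/eqmodP]. Qed.

Lemma coset_rel_repr x : coset_rel (repr (\pi_Q x)) x.
Proof. by apply/quotient_eqE; rewrite reprK. Qed.

Lemma coset_relM x x' y y' :
  coset_rel x x' -> coset_rel y y' -> coset_rel (x * y) (x' * y').
Proof.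
rewrite /coset_rel => Hx Hy.
have -> : (x * y)^-1 * (x' * y') = (x^-1 * x') ^ y * (y^-1 * y').
  by rewrite /conjg invgM !mulgA mulgK.
by rewrite gpredM // nN.
Qed.

Lemma coset_relV x x' : coset_rel x x' -> coset_rel x^-1 x'^-1.
Proof.
rewrite /coset_rel => Hx; rewrite invgK.
have -> : x * x'^-1 = ((x^-1 * x')^-1) ^ x^-1.
  by rewrite /conjg invgM !invgK !mulgA mulgK.
by rewrite nN // gpredV.
Qed.

Lemma quotient_mulE x y : quotient_mul (\pi_Q x) (\pi_Q y) = \pi_Q (x * y).
Proof. by apply/quotient_eqE; apply: coset_relM; apply: coset_rel_repr. Qed.

Lemma quotient_invE x : quotient_inv (\pi_Q x) = \pi_Q x^-1.
Proof. by apply/quotient_eqE; apply: coset_relV; apply: coset_rel_repr. Qed.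

Lemma quotient_mulA : associative quotient_mul.
Proof.
move=> a b c; elim/(@quotW _ Q): a => x; elim/(@quotW _ Q): b => y.
by elim/(@quotW _ Q): c => z; rewrite !quotient_mulE mulgA.
Qed.

Lemma quotient_mul1g : left_id quotient_one quotient_mul.
Proof. by move=> a; elim/(@quotW _ Q): a => x; rewrite quotient_mulE mul1g. Qed.

Lemma quotient_mulg1 : right_id quotient_one quotient_mul.
Proof. by move=> a; elim/(@quotW _ Q): a => x; rewrite quotient_mulE mulg1. Qed.

Lemma quotient_mulVg : left_inverse quotient_one quotient_inv quotient_mul.
Proof. by move=> a; elim/(@quotW _ Q): a => x; rewrite quotient_invE quotient_mulE mulVg. Qed.

Lemma quotient_mulgV : right_inverse quotient_one quotient_inv quotient_mul.
Proof. by move=> a; elim/(@quotW _ Q): a => x; rewrite quotient_invE quotient_mulE mulgV. Qed.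

HB.instance Definition _ := isGroup.Build Q
  quotient_mulA quotient_mul1g quotient_mulg1 quotient_mulVg quotient_mulgV.

End QuotientGroup.

Section DerivedGroup.
Variable G : groupType.

Definition derived_pred : {pred G} := fun x =>
  `[< forall S : groupClosed G, (forall a b : G, [~ a, b] \in S) -> x \in S >].

Lemma derived_pred_mul : {in derived_pred &, forall x y, x * y \in derived_pred}.
Proof.
move=> x y /asboolP Hx /asboolP Hy; apply/asboolP => S HS.
by rewrite gpredM ?Hx ?Hy.
Qed.

Lemma derived_pred_one : 1 \in derived_pred.
Proof. by apply/asboolP => S _; exact: gpred1. Qed.

Lemma derived_pred_inv : {in derived_pred, forall x, x^-1 \in derived_pred}.
Proof. by move=> x /asboolP Hx; apply/asboolP => S HS; rewrite gpredV Hx. Qed.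

HB.instance Definition _ := isMulClosed.Build G derived_pred derived_pred_mul.
HB.instance Definition _ := isMul1Closed.Build G derived_pred derived_pred_one.
HB.instance Definition _ := isInvClosed.Build G derived_pred derived_pred_inv.

Definition derived : groupClosed G := derived_pred.

End DerivedGroup.

Definition isomorphic (G H : groupType) : Prop :=
  exists f : {multiplicative G -> H}, bijective f.

Definition is_integral (H G : groupType) : Prop :=
  isomorphic (subgroup (derived H)) G.

Inductive gterm : Type :=
  | TVar of nat
  | TOne
  | TMul of gterm & gterm
  | TInv of gterm.

Fixpoint geval (G : groupType) (a : nat -> G) (t : gterm) : G :=
  match t with
  | TVar i => a i
  | TOne => 1
  | TMul t1 t2 => geval a t1 * geval a t2
  | TInv t1 => (geval a t1)^-1
  end.

Definition satisfies (G : groupType) (E : gterm * gterm -> Prop) : Prop :=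
  forall e, E e -> forall a : nat -> G, geval a e.1 = geval a e.2.

Definition group_class : Type := groupType -> Prop.

Definition is_variety (V : group_class) : Prop :=
  exists E : gterm * gterm -> Prop, forall G : groupType, V G <-> satisfies G E.

Definition product_class (V W : group_class) : group_class := fun H =>
  exists (N : groupClosed H) (nN : normal N),
    V (subgroup N) /\ W (quotient_by nN).

Definition abelian_groups : group_class := fun G =>
  forall x y : G, x * y = y * x.

Lemma abelian_groups_variety : is_variety abelian_groups.
Proof.
exists (fun e => e = (TMul (TVar 0) (TVar 1), TMul (TVar 1) (TVar 0))) => G.
split=> [abG e -> a /= | HG x y]; first exact: abG.
exact: (HG _ erefl (fun i => if i is 0 then x else y)).
Qed.

Definition integrals_of (V : group_class) : group_class := fun H =>
  exists G : groupType, V G /\ is_integral H G.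

(* Main.v *)
From HB Require Import structures.
Require Import Defs.
From mathcomp Require Import all_boot.
From mathcomp Require Import boolp.

Set Implicit Arguments.
Unset Strict Implicit.
Unset Printing Implicit Defensive.

Local Open Scope group_scope.
Local Open Scope quotient_scope.

(** Two facts carry the proof.

    The derived group is the least normal subgroup with abelian quotient, and a
    variety is closed under subgroups. Hence both classes in the theorem
    consist of the groups [H] whose derived group [H'] lies in [V]: if [N] is
    in [V] and [H / N] is abelian then [H'] is a subgroup of [N]; conversely
    [H'] itself serves as [N] ([integrals_ofE], [product_abelianE]).

    It remains to axiomatize the condition that [H'] lies in [V]. Every element
    of [H'] is the value of some word that takes its values in the derived
    group of every group, such as a product of commutators
    ([derived_word_value]). So if [V] is defined by [E], the condition is
    equivalent to the identities obtained from those of [E] by substituting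
    such words for the variables ([derived_identities]). One point needs care:
    in an instance of an identity in [H'], the elements substituted for the
    variables are values of words under unrelated assignments, whereas an
    identity of [H] uses a single assignment. Renaming the variables apart, by
    an injection of [nat * nat] into [nat], reconciles the two
    ([geval_rename_apart]). *)

(** * Terms, substitutions and subgroups *)

Fixpoint gsubst (w : nat -> gterm) (t : gterm) : gterm :=
  match t with
  | TVar i => w i
  | TOne => TOne
  | TMul t1 t2 => TMul (gsubst w t1) (gsubst w t2)
  | TInv t1 => TInv (gsubst w t1)
  end.

Lemma geval_subst (G : groupType) (a : nat -> G) (w : nat -> gterm) (t : gterm) :
  geval a (gsubst w t) = geval (fun i => geval a (w i)) t.
Proof. by elim: t => //= [t1 -> t2 ->|t1 ->]. Qed.

Lemma eq_geval (G : groupType) (a b : nat -> G) (t : gterm) :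
  a =1 b -> geval a t = geval b t.
Proof. by move=> eq_ab; elim: t => //= [t1 -> t2 ->|t1 ->]. Qed.

Lemma multiplicative1 (G H : groupType) (f : {multiplicative G -> H}) : f 1 = 1.
Proof. by apply: (mulgI (f 1)); rewrite -gmulfM !mulg1. Qed.

Lemma multiplicativeV (G H : groupType) (f : {multiplicative G -> H}) x :
  f x^-1 = (f x)^-1.
Proof.
by apply: (mulgI (f x)); rewrite -gmulfM !mulgV multiplicative1.
Qed.

Lemma geval_morph (G H : groupType) (f : {multiplicative G -> H})
    (a : nat -> G) (t : gterm) :
  geval (fun i => f (a i)) t = f (geval a t).
Proof.
elim: t => [i||t1 IH1 t2 IH2|t1 IH1] /=; first by [].
- by rewrite multiplicative1.
- by rewrite IH1 IH2 gmulfM.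
- by rewrite IH1 multiplicativeV.
Qed.

Lemma satisfies_inj (G H : groupType) (f : {multiplicative G -> H}) E :
  injective f -> satisfies H E -> satisfies G E.
Proof. by move=> f_inj HE e Ee a; apply: f_inj; rewrite -!geval_morph HE. Qed.

(** Reading the identities of a subgroup inside the ambient group lets
    subgroups be compared by inclusion, without maps between their types. *)
Lemma satisfies_subgroup (G : groupType) (S : groupClosed G) E :
  satisfies (subgroup S) E <->
  (forall e, E e -> forall a : nat -> G, (forall i, a i \in S) ->
     geval a e.1 = geval a e.2).
Proof.
split=> [SE e Ee a aS | SE e Ee a].
  have := congr1 val (SE e Ee (fun i => exist _ (a i) (aS i))).
  by rewrite -!geval_morph.
by apply: val_inj; rewrite -!geval_morph SE // => i; exact: valP.
Qed.

Lemma satisfies_subgroupS (G : groupType) (S T : groupClosed G) E :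
  {subset S <= T} -> satisfies (subgroup T) E -> satisfies (subgroup S) E.
Proof.
move=> sST /satisfies_subgroup TE; apply/satisfies_subgroup => e Ee a aS.
by apply: TE => // i; apply/sST/aS.
Qed.

(** * The derived group and abelian quotients *)

Lemma derived_commg (G : groupType) (a b : G) : [~ a, b] \in derived G.
Proof. by apply/asboolP => S; apply. Qed.

Lemma derived_normal (G : groupType) : normal (derived G).
Proof.
(* A conjugate [x ^ y] differs from [x] by the commutator of [x] and [y]. *)
move=> x y xG'; have -> : x ^ y = x * [~ x, y] by rewrite mulVKg.
by rewrite gpredM // derived_commg.
Qed.

Lemma quotient_abelianP (G : groupType) (N : groupClosed G) (nN : normal N) :
  abelian_groups (quotient_by nN) <-> {subset derived G <= N}.
Proof.
have commE (x y : G) : (x * y)^-1 * (y * x) = [~ y, x].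
  by rewrite /commg /conjg invgM !mulgA.
split=> [abQ x /asboolP | sG'N a b].
  apply=> a b; rewrite -commE.
  apply/(quotient_eqE nN); rewrite -!quotient_mulE; exact: abQ.
elim/(@quotW _ (quotient_by nN)): a => x.
elim/(@quotW _ (quotient_by nN)): b => y.
rewrite -[LHS]/(quotient_mul _ _) -[RHS]/(quotient_mul _ _) !quotient_mulE.
by apply/quotient_eqE; rewrite /coset_rel commE; apply/sG'N/derived_commg.
Qed.

Lemma integrals_ofE (V : group_class) (H : groupType) :
  is_variety V -> integrals_of V H <-> V (subgroup (derived H)).
Proof.
case=> E VE; split=> [[G [VG [f /bij_inj f_inj]]] | VH'].
  by apply/VE; apply: satisfies_inj f_inj _; apply/VE.
by exists (subgroup (derived H)); split=> //; exists idfun; exists idfun.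
Qed.

Lemma product_abelianE (V : group_class) (H : groupType) :
  is_variety V ->
  product_class V abelian_groups H <-> V (subgroup (derived H)).
Proof.
case=> E VE; split=> [[N [nN [/VE VN /quotient_abelianP sH'N]]] | VH'].
  by apply/VE; apply: satisfies_subgroupS VN.
exists (derived H), (@derived_normal H); split=> //.
exact/quotient_abelianP.
Qed.

(** * Words with values in the derived group *)

(** Membership is required semantically, in all groups at once; this covers the
    products of commutators and is visibly stable under substitution. *)
Definition derived_word (w : gterm) : Prop :=
  forall (G : groupType) (a : nat -> G), geval a w \in derived G.

Lemma derived_word_subst (v : nat -> gterm) (w : gterm) :
  derived_word w -> derived_word (gsubst v w).
Proof. by move=> w' G a; rewrite geval_subst. Qed.

Section RenameApart.
Variable I : countType.

Definition rename_apart (i : I) : gterm -> gterm :=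
  gsubst (fun j => TVar (pickle (i, j))).

Definition merge_assignments (G : groupType) (b : I -> nat -> G) (k : nat) : G :=
  if unpickle k is Some (i, j) then b i j else 1.

(** Countably many assignments can be merged into one, since a variable can
    record which assignment it is to be read in. *)
Lemma geval_rename_apart (G : groupType) (b : I -> nat -> G) i w :
  geval (merge_assignments b) (rename_apart i w) = geval (b i) w.
Proof.
rewrite geval_subst; apply: eq_geval => j /=.
by rewrite /merge_assignments pickleK.
Qed.

End RenameApart.

Section DerivedWordValues.
Variable G : groupType.

Definition derived_value : {pred G} := fun x =>
  `[< exists w (a : nat -> G), derived_word w /\ x = geval a w >].

Lemma derived_value_mul :
  {in derived_value &, forall x y, x * y \in derived_value}.
Proof.
move=> _ _ /asboolP[v [a [v' ->]]] /asboolP[w [b [w' ->]]]; apply/asboolP.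
pose c (i : bool) := if i then a else b.
exists (TMul (rename_apart true v) (rename_apart false w)).
exists (merge_assignments c); split=> [K d /=|].
  by rewrite gpredM //; apply: derived_word_subst.
by rewrite /= !geval_rename_apart.
Qed.

Lemma derived_value_one : 1 \in derived_value.
Proof.
by apply/asboolP; exists TOne, (fun=> 1); split=> // K a; exact: gpred1.
Qed.

Lemma derived_value_inv : {in derived_value, forall x, x^-1 \in derived_value}.
Proof.
move=> _ /asboolP[w [a [w' ->]]]; apply/asboolP.
exists (TInv w), a; split=> [K b /=|//]; rewrite gpredV; exact: w'.
Qed.

HB.instance Definition _ := isMulClosed.Build G derived_value derived_value_mul.
HB.instance Definition _ := isMul1Closed.Build G derived_value derived_value_one.
HB.instance Definition _ := isInvClosed.Build G derived_value derived_value_inv.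

Lemma derived_value_commg (x y : G) : [~ x, y] \in derived_value.
Proof.
pose X := TVar 0; pose Y := TVar 1.
apply/asboolP; exists (TMul (TInv X) (TMul (TInv Y) (TMul X Y))).
exists (fun i => if i is 0 then x else y).
by split=> // K a; exact: derived_commg.
Qed.

(** The values of these words form a subgroup containing all commutators,
    hence containing the derived group, the least such subgroup. *)
Lemma derived_word_value (x : G) : x \in derived G ->
  exists w (a : nat -> G), derived_word w /\ x = geval a w.
Proof.
by move=> /asboolP/(_ derived_value derived_value_commg) /asboolP.
Qed.

End DerivedWordValues.

(** * Identities for the groups whose derived group satisfies given identities *)

Definition derived_identities (E : gterm * gterm -> Prop) : gterm * gterm -> Prop :=
  fun e' => exists e (w : nat -> gterm),
    [/\ E e, forall i, derived_word (w i)
      & e' = (gsubst w e.1, gsubst w e.2)].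

Lemma satisfies_derived (H : groupType) (E : gterm * gterm -> Prop) :
  satisfies (subgroup (derived H)) E <-> satisfies H (derived_identities E).
Proof.
split=> [/satisfies_subgroup H'E _ [e [w [Ee w' ->]]] a | HE].
  by rewrite /= !geval_subst; apply: H'E => // i; apply: w'.
apply/satisfies_subgroup => e Ee a aH'.
have /choice[wb wbP] : forall i, exists wb : gterm * (nat -> H),
    derived_word wb.1 /\ a i = geval wb.2 wb.1.
  by move=> i; have [w [b wP]] := derived_word_value (aH' i); exists (w, b).
pose w i := rename_apart i (wb i).1.
pose b := merge_assignments (fun i => (wb i).2).
have wa i : geval b (w i) = a i by rewrite geval_rename_apart -(wbP i).2.
have: geval b (gsubst w e.1) = geval b (gsubst w e.2).
  apply: (HE (gsubst w e.1, gsubst w e.2)); exists e, w; split=> // i.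
  exact: derived_word_subst (wbP i).1.
by rewrite !geval_subst !(eq_geval _ wa).
Qed.

Theorem proposition6p1 (V : group_class) (hV : is_variety V) :
  is_variety (integrals_of V) /\
  (forall H : groupType,
     integrals_of V H <-> product_class V abelian_groups H).
Proof.
split=> [|H]; last first.
  exact: iff_trans (integrals_ofE H hV) (iff_sym (product_abelianE H hV)).
have [E VE] := hV; exists (derived_identities E) => H.
apply: iff_trans (integrals_ofE H hV) _.
exact: iff_trans (VE _) (satisfies_derived H E).
Qed.
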